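(* Let $T_1$ be an inverse semigroup and let $\phi_1 : S \to T_1$ be a monomorphism of semigroups such that $S\phi_1$ is right ample as well as left ample in $T_1$. If $S$ is not an inverse semigroup, then $(S;T_1)$ is an antiamalgamation pair for the class of inverse semigroups; that is, for every inverse semigroup $T_2$ and every monomorphism $\phi_2 : S \to T_2$, the amalgam $(S;T_1,T_2;\phi_1,\phi_2)$ is not (strongly) embeddable in any semigroup.
   Context: Maps are written to the right of their arguments; a monomorphism is an injective semigroup homomorphism. For $x$ in an inverse semigroup, $x^{-1}$ denotes its unique inverse ($xx^{-1}x=x$, $x^{-1}xx^{-1}=x^{-1}$). A subsemigroup $U$ of an inverse semigroup $T$ is right ample in $T$ if $u^{-1}u\in U$ for all $u\in U$, and left ample in $T$ if $uu^{-1}\in U$ for all $u\in U$ (inverses taken in $T$). A semigroup amalgam $(S;T_1,T_2;\phi_1,\phi_2)$ consists of pairwise disjoint semigroups $S,T_1,T_2$ (disjointness can be arranged by passing to isomorphic copies) and monomorphisms $\phi_i:S\to T_i$, $i=1,2$. It is (strongly) embeddable if there exist a semigroup $T$ and monomorphisms $\psi_i:T_i\to T$, $i=1,2$, such that (i) $\phi_1\psi_1=\phi_2\psi_2$ (first $\phi_i$, then $\psi_i$), and (ii) for all $t_1\in T_1$, $t_2\in T_2$, if $t_1\psi_1=t_2\psi_2$ then there is $s\in S$ with $t_1=s\phi_1$ and $t_2=s\phi_2$. *)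

(* Defs.v *)
From mathcomp Require Import all_boot.
From mathcomp Require Import boolp classical_sets.

Set Implicit Arguments.
Unset Strict Implicit.
Unset Printing Implicit Defensive.

Local Open Scope group_scope.

Definition is_sinverse (T : semigroupType) (x y : T) : Prop :=
  x * y * x = x /\ y * x * y = y.

Definition inverse_semigroup (T : semigroupType) : Prop :=
  forall x : T, exists! y : T, is_sinverse x y.

(* The operation x |-> x^-1.  When T is an inverse semigroup this is the
   unique inverse of x; it is only meaningful in that case (when x has no
   inverse the value is the dummy x, and when x has several one is picked). *)
Definition sinv (T : semigroupType) (x : T) : T :=
  xget x [set y | is_sinverse x y]%classic.

Definition subsemigroup (T : semigroupType) (U : set T) : Prop :=
  forall u v : T, U u -> U v -> U (u * v).

Definition right_ample (T : semigroupType) (U : set T) : Prop :=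
  subsemigroup U /\ forall u : T, U u -> U (sinv u * u).

Definition left_ample (T : semigroupType) (U : set T) : Prop :=
  subsemigroup U /\ forall u : T, U u -> U (u * sinv u).

(* The amalgam (S; T1, T2; phi1, phi2) is given by its two morphisms.  No
   disjointness hypothesis is needed: nothing below compares elements of
   S, T1 and T2 except through the maps, so they act as disjoint copies even
   when two of the types coincide. *)
Definition strongly_embeddable (S T1 T2 : semigroupType)
    (phi1 : {multiplicative S -> T1}) (phi2 : {multiplicative S -> T2}) : Prop :=
  exists (T : semigroupType) (psi1 : {multiplicative T1 -> T})
         (psi2 : {multiplicative T2 -> T}),
    [/\ injective psi1, injective psi2,
        forall s : S, psi1 (phi1 s) = psi2 (phi2 s)
      & forall (t1 : T1) (t2 : T2), psi1 t1 = psi2 t2 ->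
          exists s : S, t1 = phi1 s /\ t2 = phi2 s].

Definition antiamalgamation_pair (C : semigroupType -> Prop)
    (S T1 : semigroupType) (phi1 : {multiplicative S -> T1}) : Prop :=
  forall T2 : semigroupType, C T2 ->
  forall phi2 : {multiplicative S -> T2}, injective phi2 ->
    ~ strongly_embeddable phi1 phi2.

(* Main.v *)
Require Import Defs.
From mathcomp Require Import all_boot.
From mathcomp Require Import boolp classical_sets.

(** In a semigroup, any two inverses x and y of an element c give mutually
inverse idempotents x * c and y * c, as well as c * x and c * y.

Suppose that the amalgam embeds in a semigroup T.  An element s of S becomes
there an element c which has one inverse x coming from T1 and one inverse y
coming from T2.  Right ampleness says that x * c comes from S, hence also from
T2, where y * c lives as well.  So x * c and y * c are both inverses of x * c
in T2, where inverses are unique: they coincide.  Left ampleness gives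
c * x = c * y in the same way.  Therefore x = x * c * x = y * c * x =
y * c * y = y belongs to both T1 and T2, and strong embeddability puts it in S:
every element of S has an inverse in S.  It is unique because S embeds in T1,
so S would be an inverse semigroup. *)

Local Open Scope group_scope.

Lemma sinvP {T : semigroupType} (x : T) :
  inverse_semigroup T -> is_sinverse x (sinv x).
Proof.
move=> /(_ x) [y [xy _]].
exact: (@xgetPex _ x [set z | is_sinverse x z]%classic (ex_intro _ y xy)).
Qed.

Lemma sinverse_unique {T : semigroupType} {x y z : T} :
  inverse_semigroup T -> is_sinverse x y -> is_sinverse x z -> y = z.
Proof. by move=> /(_ x) [w [_ uniq_w]] /uniq_w <- /uniq_w <-. Qed.

Lemma is_sinverse_morph {S T : semigroupType} (f : {multiplicative S -> T})
    {x y : S} : is_sinverse x y -> is_sinverse (f x) (f y).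
Proof. by case=> xyx yxy; split; rewrite -!gmulfM ?xyx ?yxy. Qed.

Lemma is_sinverse_inj {S T : semigroupType} {f : {multiplicative S -> T}}
    {x y : S} : injective f -> is_sinverse (f x) (f y) -> is_sinverse x y.
Proof. by move=> f_inj [xyx yxy]; split; apply: f_inj; rewrite !gmulfM. Qed.

(** In the products x * c * (y * c) * (x * c) and y * c * (x * c) * (y * c) every
factor c * x * c or c * y * c collapses to c.  The case x = y is also of use: it
says that x * c is its own inverse. *)
Lemma is_sinverse_mull {T : semigroupType} {c x y : T} :
  is_sinverse c x -> is_sinverse c y -> is_sinverse (x * c) (y * c).
Proof.
rewrite /is_sinverse -!mulgA => -[cxc _] [cyc _].
by split; rewrite ?cxc ?cyc ?cxc.
Qed.

Lemma is_sinverse_mulr {T : semigroupType} {c x y : T} :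
  is_sinverse c x -> is_sinverse c y -> is_sinverse (c * x) (c * y).
Proof.
by move=> [cxc _] [cyc _]; split; rewrite !mulgA ?cxc ?cyc ?cxc.
Qed.

(** Indeed x = (x * c) * x = (y * c) * x = y * (c * x) = y * (c * y) = y. *)
Lemma sinverse_eq {T : semigroupType} {c x y : T} :
  is_sinverse c x -> is_sinverse c y -> x * c = y * c -> c * x = c * y -> x = y.
Proof.
move=> [_ xcx] [_ ycy] xc_yc cx_cy.
by rewrite -xcx xc_yc -mulgA cx_cy mulgA.
Qed.

(** Inverses in T need not be unique, but the two inverses g and h of g can be
compared in T2, since an embedding reflects the equations defining inverses.
It replaces the commutation of idempotents in T2. *)
Lemma sinverse_self_eq {T2 T : semigroupType} {psi : {multiplicative T2 -> T}}
    {g h : T2} :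
  inverse_semigroup T2 -> injective psi ->
  is_sinverse (psi g) (psi g) -> is_sinverse (psi g) (psi h) -> g = h.
Proof.
move=> T2_inverse psi_inj gg gh.
exact: sinverse_unique T2_inverse (is_sinverse_inj psi_inj gg)
  (is_sinverse_inj psi_inj gh).
Qed.

Theorem theorem3p2 (S T1 : semigroupType) (phi1 : {multiplicative S -> T1})
    (T1_inverse : inverse_semigroup T1) (phi1_inj : injective phi1)
    (S_right_ample : right_ample (range phi1))
    (S_left_ample : left_ample (range phi1))
    (S_not_inverse : ~ inverse_semigroup S) :
  antiamalgamation_pair inverse_semigroup phi1.
Proof.
move=> T2 T2_inverse phi2 _ [T [psi1 [psi2 [_ psi2_inj psi_phi meet]]]].
apply: S_not_inverse => s.
have [_ /(_ (phi1 s)) [|e _ phi_e]] := S_right_ample; first by exists s.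
have [_ /(_ (phi1 s)) [|f _ phi_f]] := S_left_ample; first by exists s.
have s_inv1 := sinvP (phi1 s) T1_inverse.
set x := sinv (phi1 s) in phi_e phi_f s_inv1.
have s_inv2 := sinvP (phi2 s) T2_inverse.
set y := sinv (phi2 s) in s_inv2.
have cx := is_sinverse_morph psi1 s_inv1.
have cy := is_sinverse_morph psi2 s_inv2.
rewrite -psi_phi in cy.
have psi_e : psi2 (phi2 e) = psi1 x * psi1 (phi1 s).
  by rewrite -psi_phi phi_e gmulfM.
have psi_f : psi2 (phi2 f) = psi1 (phi1 s) * psi1 x.
  by rewrite -psi_phi phi_f gmulfM.
(* Here x * c and y * c are compared, with c the image of s in T. *)
have e_eq : phi2 e = y * phi2 s.
  apply: (sinverse_self_eq T2_inverse psi2_inj).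
    by rewrite psi_e; apply: is_sinverse_mull.
  by rewrite psi_e gmulfM -psi_phi; apply: is_sinverse_mull.
have f_eq : phi2 f = phi2 s * y.
  apply: (sinverse_self_eq T2_inverse psi2_inj).
    by rewrite psi_f; apply: is_sinverse_mulr.
  by rewrite psi_f gmulfM -psi_phi; apply: is_sinverse_mulr.
have xy : psi1 x = psi2 y.
  apply: (sinverse_eq cx cy).
    by rewrite -psi_e e_eq gmulfM psi_phi.
  by rewrite -psi_f f_eq gmulfM psi_phi.
(* The common value of the two inverses of s lies in the core S. *)
have [r [x_r _]] := meet x y xy.
rewrite x_r in s_inv1.
exists r; split=> [|r' sr']; first exact: is_sinverse_inj phi1_inj s_inv1.
apply: phi1_inj.
exact: sinverse_unique T1_inverse s_inv1 (is_sinverse_morph phi1 sr').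
Qed.
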